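(* Fix $p\in(0,1)$ and $\varepsilon\in(0,1)$. Consider oracular search among $N$ items (marked element uniformly random) by algorithms of the following (''exclusion round'') class, which may depend on $p$. The algorithm proceeds in rounds $g=0,1,\ldots,r$; before round $g$, $g$ previously tested items have been excluded, and round $g$ operates on a quantum register $\mathbb{C}^{N-g}\otimes\mathbb{C}^M$ (the first factor spanned by the non-excluded items) subject to partial depolarizing noise $D_p(\varrho)=p\frac{I_d}{d}\mathrm{Tr}(\varrho)+(1-p)\varrho$ ($d$ the register dimension): it prepares $\varrho^x=T_{k_g}'\widehat{O}_xT_{k_g}D_p\cdots D_pT_1'\widehat{O}_xT_1D_p(\varrho_0)$ using $k_g$ oracle calls $\widehat{O}_x(|y\rangle\langle y'|\otimes\sigma)=(-1)^{\delta_{xy}+\delta_{xy'}}|y\rangle\langle y'|\otimes\sigma$ (arbitrary initial state and $x$-independent channels), measures a POVM to obtain a guess among the non-excluded items, verifies it with one further noiseless oracle query (storing it if correct), and otherwise excludes it. It is assumed that failure probabilities are multiplicative: the overall failure probability equals $\prod_{g=0}^r(1-p_s^{(g)})$, where $p_s^{(g)}$ is round $g$'s success probability averaged over the marked element uniformly distributed among the $N-g$ non-excluded items. The number of queries is $q_N=\sum_{g=0}^r(k_g+1)$. For each $N$ let such an algorithm find the marked element except with failure probability at most $\varepsilon$, using $q_N$ queries. Then there is a sequence $C_N=C_N(\varepsilon,p)$ with $\lim_{N\to\infty}C_N=1$ such that $$q_N\ge\frac{N}{1+\frac{8C_N}{p\log(1/\varepsilon)}}.$$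
   Context: $\log$ is the natural logarithm. Noise $D_p$ is applied once between consecutive oracle invocations as in the displayed formula; channels are completely positive trace-preserving maps. *)

(* Defs.v *)
From HB Require Import structures.
From mathcomp Require Import all_boot all_order all_algebra.
From mathcomp Require Import all_classical all_reals all_analysis.
From mathcomp Require Import complex.
Set Implicit Arguments. Unset Strict Implicit. Unset Printing Implicit Defensive.
Import Order.TTheory GRing.Theory Num.Theory.
Local Open Scope ring_scope.
Local Open Scope complex_scope.

Section Quantum.
Variable R : realType.
Local Notation C := R[i].

Definition adjmx m n (A : 'M[C]_(m, n)) : 'M[C]_(n, m) := (map_mx conjc A)^T.

Definition psd d (A : 'M[C]_d) : Prop :=
  forall v : 'cV[C]_d, 0 <= (adjmx v *m A *m v) 0 0.

Definition density d (rho : 'M[C]_d) : Prop := psd rho /\ \tr rho = 1.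

Definition povm d K (E : 'I_K -> 'M[C]_d) : Prop :=
  (forall i, psd (E i)) /\ \sum_(i < K) E i = 1%:M.

(* Complete positivity of Phi, written out: for every n, id_n (x) Phi maps
   positive semidefinite block matrices (X_ab)_{a,b<n} (blocks in 'M_d) to
   positive semidefinite block matrices (Phi X_ab)_{a,b}.  A block matrix
   (Y_ab) is PSD iff sum_{a,b} w_a^dagger Y_ab w_b >= 0 for all w. *)
Definition block_psd n d (X : 'I_n -> 'I_n -> 'M[C]_d) : Prop :=
  forall w : 'I_n -> 'cV[C]_d,
    0 <= \sum_(a < n) \sum_(b < n) (adjmx (w a) *m X a b *m w b) 0 0.

Definition completely_positive d d' (Phi : 'M[C]_d -> 'M[C]_d') : Prop :=
  forall n (X : 'I_n -> 'I_n -> 'M[C]_d),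
    block_psd X -> block_psd (fun a b => Phi (X a b)).

Definition cptp d d' (Phi : 'M[C]_d -> 'M[C]_d') : Prop :=
  linear Phi /\ completely_positive Phi /\ (forall A, \tr (Phi A) = \tr A).

Definition depol (p : R) d (rho : 'M[C]_d) : 'M[C]_d :=
  (p%:C / d%:R * \tr rho) *: 1%:M + (1 - p)%:C *: rho.

(* Register C^K (x) C^M, basis index u = y * M + m  (Kronecker/mxvec order),
   so the first-factor item of u is u %/ M. Oracle:
   O_x(|y><y'| (x) s) = (-1)^(d_xy + d_xy') |y><y'| (x) s, i.e. U rho U with
   U the diagonal sign unitary. *)
Definition oracle_sign K M (x : 'I_K) : 'M[C]_(K * M) :=
  diag_mx (\row_(u < K * M) (if (u %/ M)%N == x then -1 else 1)).

Definition oracle K M (x : 'I_K) (rho : 'M[C]_(K * M)) : 'M[C]_(K * M) :=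
  oracle_sign M x *m rho *m oracle_sign M x.

Record round (K M : nat) := Round {
  nq : nat;
  init : 'M[C]_(K * M);
  chT : nat -> 'M[C]_(K * M) -> 'M[C]_(K * M);  (* T_{i+1},  i < k_g *)
  chT' : nat -> 'M[C]_(K * M) -> 'M[C]_(K * M); (* T'_{i+1}, i < k_g *)
  meas : 'I_K -> 'M[C]_(K * M)
}.

Definition round_valid K M (rd : round K M) : Prop :=
  density (init rd) /\
  (forall i, (i < nq rd)%N -> cptp (chT rd i) /\ cptp (chT' rd i)) /\
  povm (meas rd).

Definition round_state (p : R) K M (rd : round K M) (x : 'I_K) : 'M[C]_(K * M) :=
  foldl (fun rho i => chT' rd i (oracle x (chT rd i (depol p rho))))
        (init rd) (iota 0 (nq rd)).

Definition round_success (p : R) K M (rd : round K M) : R :=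
  K%:R^-1 * \sum_(x < K) complex.Re (\tr (meas rd x *m round_state p rd x)).

Record excl_alg (N : nat) := ExclAlg {
  nrounds : nat;
  anc : nat;
  rounds : forall g : 'I_nrounds.+1, round (N - g) anc
}.


Arguments rounds [N] e g : rename.
Definition alg_valid N (A : excl_alg N) : Prop :=
  (nrounds A < N)%N /\ forall g, round_valid (@rounds N A g).

Definition alg_failure (p : R) N (A : excl_alg N) : R :=
  \prod_(g < (nrounds A).+1) (1 - round_success p (@rounds N A g)).

Definition alg_queries N (A : excl_alg N) : nat :=
  (\sum_(g < (nrounds A).+1) (nq (@rounds N A g)).+1)%N.

End Quantum.

(* Main.v *)
Require Import Defs.
From HB Require Import structures.
From mathcomp Require Import all_boot all_order all_algebra.
From mathcomp Require Import all_classical all_reals all_analysis.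
From mathcomp Require Import complex ring lra.
Import Order.TTheory GRing.Theory Num.Theory.
Local Open Scope classical_set_scope.
Local Open Scope ring_scope.

(** Fix a round with K items.  A noisy run is a mixture, over the position of the
    last step at which the depolarizing noise fired, of noiseless runs of j oracle
    calls started from a state that does not depend on x.  A hybrid argument bounds
    the summed success probability of such a run by (2j+1)^2.  Averaging over the
    geometric law of j gives K * (success) <= 1 + 8 \sum_(i < k) (i+1)(1-p)^i, which is
    at most both (8/p)(k+1) and 1 + 8/p^2.  The second bound makes each success
    probability small when N - q is of order N, so that the product of the failure
    probabilities is close to exp(- \sum_g success_g), and the first bound turns this
    into log(1/eps) (N - q) <= C_N (8/p) q.

    The hybrid argument avoids Stinespring dilations: instead of purifications psi of
    the oracle-free run and psi_x of the run with oracle x, it propagates the 2x2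
    block matrix of partial traces of |psi_a><psi_b|, whose positivity is preserved
    by completely positive maps by definition. *)

Section Rounds.
Set Implicit Arguments. Unset Strict Implicit. Unset Printing Implicit Defensive.
Variable R : realType.
Local Notation C := R[i].
Local Open Scope complex_scope.

(** * Adjoints, positivity and real parts of traces *)

Lemma Re_ge0 (z : C) : 0 <= z -> 0 <= complex.Re z.
Proof. by rewrite lecE => /andP[]. Qed.

Lemma adjmxM m n k (A : 'M[C]_(m, n)) (B : 'M[C]_(n, k)) :
  adjmx (A *m B) = adjmx B *m adjmx A.
Proof. by rewrite /adjmx map_mxM trmx_mul. Qed.

Lemma adjmxD m n (A B : 'M[C]_(m, n)) : adjmx (A + B) = adjmx A + adjmx B.
Proof. by rewrite /adjmx map_mxD linearD. Qed.

Lemma adjmxZ m n (c : C) (A : 'M[C]_(m, n)) : adjmx (c *: A) = c^* *: adjmx A.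
Proof. by rewrite /adjmx map_mxZ linearZ. Qed.

Lemma adjmxK m n (A : 'M[C]_(m, n)) : adjmx (adjmx A) = A.
Proof. by apply/matrixP => i j; rewrite !mxE conjcK. Qed.

Lemma adjmx_sum m n I (s : seq I) (P : pred I) (F : I -> 'M[C]_(m, n)) :
  adjmx (\sum_(i <- s | P i) F i) = \sum_(i <- s | P i) adjmx (F i).
Proof. by rewrite /adjmx map_mx_sum linear_sum. Qed.

(** A nonnegative complex number is real, so the quadratic form is real on every vector. Its
    imaginary parts at [e_i + c e_j], for [c] equal to 0, 1 and ['i], tie [A i j] to the conjugate
    of [A j i]. *)
Lemma psd_adj d (A : 'M[C]_d) : psd A -> adjmx A = A.
Proof.
move=> hA; apply/matrixP => i j; rewrite !mxE.
pose v (i j : 'I_d) (c : C) : 'cV[C]_d := delta_mx i 0 + c *: delta_mx j 0.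
have form (k l : 'I_d) (c : C) : (adjmx (v k l c) *m A *m v k l c) 0 0 =
     (A k k + c * A k l) + c^* * (A l k + c * A l l).
  have ad (r : 'I_d) : adjmx (delta_mx r 0 : 'cV[C]_d) = delta_mx 0 r.
    by apply/matrixP => a b; rewrite !mxE andbC; case: (_ && _); simpc.
  have e (r s : 'I_d) : ((delta_mx 0 r : 'rV[C]_d) *m A *m (delta_mx s 0 : 'cV[C]_d)) 0 0 = A r s.
    by rewrite -matrix.rowE -colE !mxE.
  rewrite /v adjmxD adjmxZ !ad !mulmxDl !mulmxDr.
  rewrite -!scalemxAl -!scalemxAr.
  by rewrite ![fun_of_matrix (_ + _) _ _]mxE ![fun_of_matrix (_ *: _) _ _]mxE !e mulrDr.
have pos k l c : 0 <= (A k k + c * A k l) + c^* * (A l k + c * A l l).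
  by rewrite -form; exact: hA.
clear v form.
move: (pos i j 1) (pos i j 'i) (pos i j 0) (pos j i 0).
case: (A i i) => a b; case: (A j j) => a' b'; case: (A i j) => u w.
case: (A j i) => u1 w1.
rewrite !lecE /= => /andP[/eqP h1 _] /andP[/eqP h2 _] /andP[/eqP h3 _] /andP[/eqP h4 _].
by congr (_ +i* _); lra.
Qed.

Definition rtr d (A : 'M[C]_d) : R := complex.Re (\tr A).

(** In an eigenbasis of [A], the trace is the sum of the eigenvalues of [A] times the diagonal
    entries of [B], all nonnegative. *)
Lemma psd_mxtrace_mul_ge0 d (A B : 'M[C]_d) :
  psd A -> psd B -> 0 <= rtr (A *m B).
Proof.
move=> hA hB; rewrite /rtr.
have herm : (A \is hermsymmx)%R.
  apply/is_hermitianmxP; rewrite expr0 scale1r -[LHS](psd_adj hA).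
  by apply/matrixP => i j; rewrite !mxE.
have /orthomx_spectralP := hermitian_normalmx herm.
rewrite invmx_unitary ?spectral_unitarymx//.
set V := spectralmx A; set D := spectral_diag A => defA.
have hV : V *m adjmx V = 1%:M.
  have /unitarymxP <- := spectral_unitarymx A.
  by congr (_ *m _); apply/matrixP => i j; rewrite !mxE.
have defA' : A = adjmx V *m diag_mx D *m V.
  by rewrite [LHS]defA; congr (_ *m _ *m _); apply/matrixP => i j; rewrite !mxE.
have diag_ge0 (X : 'M[C]_d) i : psd X -> 0 <= (V *m X *m adjmx V) i i.
  move=> hX; have := hX (adjmx (row i V)).
  rewrite adjmxK -row_mul !mxE; congr (0 <= _); apply: eq_bigr => k _.
  by rewrite !mxE.
have defD : diag_mx D = V *m A *m adjmx V.
  by rewrite defA' !mulmxA hV mul1mx -mulmxA hV mulmx1.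
have -> : \tr (A *m B) = \tr (diag_mx D *m (V *m B *m adjmx V)).
  by rewrite {1}defA' -2!mulmxA (mxtrace_mulC (adjmx V)) !mulmxA.
apply: Re_ge0; rewrite /mxtrace; apply: sumr_ge0 => i _.
rewrite mul_diag_mx mxE mulr_ge0 ?diag_ge0//.
have := diag_ge0 _ i hA; by rewrite -defD [fun_of_matrix (diag_mx _) _ _]mxE eqxx mulr1n.
Qed.

Lemma rtrD d (A B : 'M[C]_d) : rtr (A + B) = rtr A + rtr B.
Proof. by rewrite /rtr linearD /=; case: (\tr A) => a b; case: (\tr B) => a' b'. Qed.

Lemma rtrZ d (a : R) (A : 'M[C]_d) : rtr (a%:C *: A) = a * rtr A.
Proof. by rewrite /rtr linearZ /=; case: (\tr A) => b c /=; rewrite mul0r subr0. Qed.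

Lemma rtrN d (A : 'M[C]_d) : rtr (- A) = - rtr A.
Proof. by rewrite /rtr linearN /=; case: (\tr A). Qed.

Lemma rtr_sum d I (s : seq I) (P : pred I) (F : I -> 'M[C]_d) :
  rtr (\sum_(i <- s | P i) F i) = \sum_(i <- s | P i) rtr (F i).
Proof.
elim/big_rec2: _ => [|i y1 y2 _ <-]; last by rewrite rtrD.
by rewrite /rtr linear0.
Qed.

Lemma rtrC m n (A : 'M[C]_(m, n)) (B : 'M[C]_(n, m)) : rtr (A *m B) = rtr (B *m A).
Proof. by rewrite /rtr mxtrace_mulC. Qed.

(** * Positive 2x2 block matrices and parametrized triangle inequalities *)

Lemma sum_ord2 (V : zmodType) (F : 'I_2 -> V) : \sum_(a < 2) F a = F 0 + F 1.
Proof. by rewrite big_ord_recl big_ord1; congr (F _ + F _); exact: val_inj. Qed.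

Lemma block_psd_rtr_ge0 d m (X : 'I_2 -> 'I_2 -> 'M[C]_d) (A B : 'M[C]_(d, m)) :
  block_psd X ->
  0 <= rtr (adjmx A *m X 0 0 *m A) + rtr (adjmx A *m X 0 1 *m B)
     + rtr (adjmx B *m X 1 0 *m A) + rtr (adjmx B *m X 1 1 *m B).
Proof.
move=> hX; rewrite -!rtrD /rtr.
apply: Re_ge0; rewrite /mxtrace; apply: sumr_ge0 => i _.
have := hX (fun a => if a == 0 then col i A else col i B).
rewrite !sum_ord2 /=.
have e (P Q : 'M[C]_(d, m)) (Y : 'M[C]_d) :
    (adjmx (col i P) *m Y *m col i Q) 0 0 = (adjmx P *m Y *m Q) i i.
  rewrite mxE [RHS]mxE; apply: eq_bigr => k _; rewrite [col i Q _ _]mxE; congr (_ * _).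
  by rewrite mxE [RHS]mxE; apply: eq_bigr => l _; rewrite !mxE.
by rewrite !e ![fun_of_matrix (_ + _) _ _]mxE !addrA.
Qed.

Lemma adjmxZ_real m n (a : R) (A : 'M[C]_(m, n)) : adjmx (a%:C *: A) = a%:C *: adjmx A.
Proof. by rewrite adjmxZ; congr (_ *: _); exact: conjc_real. Qed.

Lemma mulmx_involution (K : comNzRingType) d (U : 'M[K]_d) (a b c e : K) :
  U *m U = 1%:M ->
  (a *: 1%:M + b *: U) *m (c *: 1%:M + e *: U) =
  (a * c + b * e) *: 1%:M + (a * e + b * c) *: U.
Proof.
move=> hU; rewrite mulmxDl !mulmxDr -!(scalemxAl, scalemxAr) !mul1mx mulmx1 hU.
by rewrite !scalerA !scalerDl [X in _ + X = _]addrC addrACA.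
Qed.

Lemma rtr_mulDZ d (a b : R) (U Y : 'M[C]_d) :
  rtr ((a%:C *: 1%:M + b%:C *: U) *m Y) = a * rtr Y + b * rtr (U *m Y).
Proof. by rewrite mulmxDl rtrD -2!scalemxAl 2!rtrZ mul1mx. Qed.

(* || psi_1 - psi_0 ||^2 when X a b is a partial trace of |psi_a><psi_b|. *)
Definition gap d (X : 'I_2 -> 'I_2 -> 'M[C]_d) : R :=
  rtr (X 0 0) - rtr (X 0 1) - rtr (X 1 0) + rtr (X 1 1).

Lemma block_psd_rtr_herm d (X : 'I_2 -> 'I_2 -> 'M[C]_d) (A B : 'M[C]_d) :
  block_psd X -> adjmx A = A -> adjmx B = B ->
  0 <= rtr (A *m A *m X 0 0) + rtr (B *m A *m X 0 1)
     + rtr (A *m B *m X 1 0) + rtr (B *m B *m X 1 1).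
Proof.
move=> hX hA hB; have := block_psd_rtr_ge0 A B hX; rewrite hA hB.
by rewrite (rtrC _ A) (rtrC _ B) (rtrC _ A) (rtrC _ B) !mulmxA.
Qed.

(* The parameter t, optimized only after summing over x, replaces the
   Cauchy-Schwarz inequality. *)
Lemma gap_oracle d (X : 'I_2 -> 'I_2 -> 'M[C]_d) (U : 'M[C]_d) (t : R) :
  block_psd X -> adjmx U = U -> U *m U = 1%:M -> 0 < t ->
  rtr (X 0 0) - rtr (X 0 1 *m U) - rtr (U *m X 1 0) + rtr (U *m X 1 1 *m U)
  <= (1 + t) * gap X + 2 * (1 + t^-1) * (rtr (X 0 0) - rtr (U *m X 0 0)).
Proof.
move=> hX hU hUU t0.
have ad1 : adjmx (1%:M : 'M[C]_d) = 1%:M by rewrite /adjmx map_mx1 trmx1.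
have adUZ a b : adjmx (a%:C *: 1%:M + b%:C *: U) = a%:C *: 1%:M + b%:C *: U.
  by rewrite adjmxD (adjmxZ_real a) (adjmxZ_real b) hU ad1.
have prod a b c e Y :
    rtr ((a%:C *: 1%:M + b%:C *: U) *m (c%:C *: 1%:M + e%:C *: U) *m Y) =
    (a * c + b * e) * rtr Y + (a * e + b * c) * rtr (U *m Y).
  by rewrite mulmx_involution// -4!rmorphM -2!rmorphD rtr_mulDZ.
(* Put [a = U (psi_1 - psi_0)] and [b = (U - 1) psi_0]. The right side minus the left is
   [|t a - b|^2 / t], and [- U (t a - b) = ((t + 1) - U) psi_0 - t psi_1] gives the two
   coefficients. *)
have := block_psd_rtr_herm hX (adUZ (t + 1) (-1)) (adUZ (- t) 0).
rewrite (prod (t + 1) (-1) (t + 1) (-1)) (prod (- t) 0 (t + 1) (-1)).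
rewrite (prod (t + 1) (-1) (- t) 0) (prod (- t) 0 (- t) 0) /gap (rtrC (X 0 1) U).
have -> : rtr (U *m X 1 1 *m U) = rtr (X 1 1) by rewrite rtrC mulmxA hUU mul1mx.
set r00 := rtr (X 0 0); set r01 := rtr (X 0 1); set r10 := rtr (X 1 0).
set r11 := rtr (X 1 1); set u00 := rtr (U *m X 0 0); set u01 := rtr (U *m X 0 1).
set u10 := rtr (U *m X 1 0); set u11 := rtr (U *m X 1 1) => h.
clearbody r00 r01 r10 r11 u00 u01 u10 u11.
rewrite -(ler_pM2l t0) -subr_ge0; move: h; congr (0 <= _).
by field; rewrite gt_eqF.
Qed.

(** Partial trace of [|phi><phi|] for [phi = a psi_0 + b psi_1]. *)
Definition comb2 d (X : 'I_2 -> 'I_2 -> 'M[C]_d) (a b : R) : 'M[C]_d :=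
  (a * a)%:C *: X 0 0 + (a * b)%:C *: (X 0 1 + X 1 0) + (b * b)%:C *: X 1 1.

Lemma psd_comb2 d (X : 'I_2 -> 'I_2 -> 'M[C]_d) (a b : R) :
  block_psd X -> psd (comb2 X a b).
Proof.
move=> hX v; pose q (Y : 'M[C]_d) := (adjmx v *m Y *m v) 0 0.
have qD A B : q (A + B) = q A + q B by rewrite /q mulmxDr mulmxDl mxE.
have qZ c A : q (c *: A) = c * q A by rewrite /q -scalemxAr -scalemxAl mxE.
have q2 r s Y : (adjmx (r%:C *: v) *m Y *m (s%:C *: v)) 0 0 = (r * s)%:C * q Y.
  by rewrite adjmxZ_real -!scalemxAl -scalemxAr scalerA mxE rmorphM.
rewrite -/(q _) /comb2 2!qD 3!qZ qD.
have := hX (fun i => (if i == 0 then a else b)%:C *: v).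
rewrite !sum_ord2 4!q2.
by rewrite (mulrC b a) mulrDr !addrA.
Qed.

Lemma rtr_mul_comb2 d (E : 'M[C]_d) (X : 'I_2 -> 'I_2 -> 'M[C]_d) (a b : R) :
  rtr (E *m comb2 X a b) = a * a * rtr (E *m X 0 0) +
    a * b * (rtr (E *m X 0 1) + rtr (E *m X 1 0)) + b * b * rtr (E *m X 1 1).
Proof.
by rewrite /comb2 2!mulmxDr 2!rtrD -3!scalemxAr 3!rtrZ mulmxDr rtrD.
Qed.

(** Triangle inequality in the seminorm [<psi|E|psi>], whose defect is the [E]-form at
    [(s + 1) psi_0 - psi_1] divided by [s]. Positivity of [1 - E] then bounds the [E]-form at
    [psi_1 - psi_0] by the gap. *)
Lemma rtr_effect_le d (X : 'I_2 -> 'I_2 -> 'M[C]_d) (E : 'M[C]_d) (s : R) :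
  block_psd X -> psd E -> psd (1%:M - E) -> 0 < s ->
  rtr (E *m X 1 1) <= (1 + s) * rtr (E *m X 0 0) + (1 + s^-1) * gap X.
Proof.
move=> hX hE hE' s0.
have := psd_mxtrace_mul_ge0 hE (psd_comb2 (s + 1) (-1) hX).
have := psd_mxtrace_mul_ge0 hE' (psd_comb2 1 (-1) hX).
rewrite rtr_mul_comb2 rtr_mul_comb2 /gap.
have sub Y : rtr ((1%:M - E) *m Y) = rtr Y - rtr (E *m Y).
  by rewrite mulmxBl mul1mx rtrD rtrN.
rewrite 4!sub.
set r00 := rtr (X 0 0); set r01 := rtr (X 0 1); set r10 := rtr (X 1 0).
set r11 := rtr (X 1 1); set e00 := rtr (E *m X 0 0); set e01 := rtr (E *m X 0 1).
set e10 := rtr (E *m X 1 0); set e11 := rtr (E *m X 1 1).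
clearbody r00 r01 r10 r11 e00 e01 e10 e11.
set A := (Z in 0 <= Z -> _) => hA; set B := (Z in 0 <= Z -> _) => hB.
rewrite -(ler_pM2l s0) -subr_ge0.
suff -> : s * ((1 + s) * e00 + (1 + s^-1) * (r00 - r01 - r10 + r11)) - s * e11 =
    (s + 1) * A + B by rewrite addr_ge0// mulr_ge0// addr_ge0// ltW.
by rewrite /A /B; field; rewrite gt_eqF.
Qed.

(** The optimal parameter is [t = b / a]; if [a] or [b] vanishes, the bound arises in the limit of
    large or small [t]. *)
Lemma minkowski_param (x a b : R) : 0 <= a -> 0 <= b ->
  (forall t, 0 < t -> x <= (1 + t) * a ^+ 2 + (1 + t^-1) * b ^+ 2) ->
  x <= (a + b) ^+ 2.
Proof.
rewrite le_eqVlt => /predU1P[<-|a0].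
  rewrite le_eqVlt add0r => /predU1P[<-|b0] h.
    by have := h 1 ltr01; rewrite expr0n !mulr0 addr0.
  apply/ler_addgt0Pr => e e0; have := h (b ^+ 2 / e) (divr_gt0 (exprn_gt0 _ b0) e0).
  rewrite expr0n mulr0 add0r invf_div mulrDl mul1r divfK//.
  by rewrite expf_neq0// gt_eqF.
rewrite le_eqVlt => /predU1P[<-|b0] h.
  rewrite addr0; apply/ler_addgt0Pr => e e0.
  have := h (e / a ^+ 2) (divr_gt0 e0 (exprn_gt0 _ a0)).
  by rewrite expr0n mulr0 addr0 mulrDl mul1r divfK// expf_neq0// gt_eqF.
apply: le_trans (h (b / a) (divr_gt0 b0 a0)) _; rewrite le_eqVlt; apply/orP; left.
by apply/eqP; field; rewrite !gt_eqF.
Qed.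

(** * Hybrid argument for noiseless runs *)

(* sigma x is reached from an x-independent state by noiseless steps with j calls
   to the oracle x; X x 0 0 = rho is the same run without oracle calls. *)
Definition shadowed K d (j : nat) (sigma : 'I_K -> 'M[C]_d) : Prop :=
  exists (rho : 'M[C]_d) (X : 'I_K -> 'I_2 -> 'I_2 -> 'M[C]_d),
  [/\ \tr rho = 1,
      forall x, [/\ block_psd (X x), X x 0 0 = rho, X x 1 1 = sigma x &
                    \tr (sigma x) = 1] &
      \sum_x gap (X x) <= (2 * j%:R) ^+ 2].

Lemma shadowed_const K d (rho : 'M[C]_d) :
  density rho -> shadowed 0 (fun _ : 'I_K => rho).
Proof.
move=> [hrho tr1]; exists rho, (fun _ _ _ => rho); split=> //.
- move=> x; split=> // w; have := hrho (\sum_a w a).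
  rewrite adjmx_sum mulmx_suml mulmx_suml summxE; congr (0 <= _).
  by apply: eq_bigr => a _; rewrite mulmx_sumr summxE.
- rewrite mulr0 expr0n big1// => x _; rewrite /gap.
  by rewrite subrr sub0r addNr.
Qed.

Lemma rtr_density d (rho : 'M[C]_d) : \tr rho = 1 -> rtr rho = 1.
Proof. by rewrite /rtr => ->. Qed.

Lemma psd_sum d I (s : seq I) (P : pred I) (F : I -> 'M[C]_d) :
  (forall i, P i -> psd (F i)) -> psd (\sum_(i <- s | P i) F i).
Proof.
move=> hF v; rewrite mulmx_sumr mulmx_suml summxE; apply: sumr_ge0 => i Pi.
exact: hF.
Qed.

(** The oracle-free run has summed success [\tr rho = 1], and the root of the summed gap, at most
    [2 j], is added to the root of this. *)
Lemma shadowed_success K d j (sigma : 'I_K -> 'M[C]_d) (E : 'I_K -> 'M[C]_d) :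
  shadowed j sigma -> povm E ->
  \sum_x rtr (E x *m sigma x) <= (1 + 2 * j%:R) ^+ 2.
Proof.
move=> [rho [X [tr1 hX hgap]]] [psdE sumE].
apply: minkowski_param => //.
move=> t t0; rewrite expr1n mulr1.
have -> : 1 + t = (1 + t) * \sum_x rtr (E x *m rho).
  by rewrite -rtr_sum -mulmx_suml sumE mul1mx rtr_density ?mulr1.
apply: (@le_trans _ _ ((1 + t) * (\sum_x rtr (E x *m rho)) +
                       (1 + t^-1) * \sum_x gap (X x))); last first.
  by rewrite lerD2l ler_wpM2l// addr_ge0// invr_ge0 ltW.
rewrite 2!mulr_sumr -big_split /=; apply: ler_sum => x _.
have [hXx <- <- _] := hX x; apply: rtr_effect_le => //.
rewrite -sumE (bigD1 x)//= addrC addrK; exact: psd_sum.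
Qed.

Lemma adjmx_oracle_sign K M (x : 'I_K) :
  adjmx (oracle_sign R M x) = oracle_sign R M x.
Proof.
rewrite /adjmx /oracle_sign map_diag_mx tr_diag_mx; congr diag_mx.
by apply/matrixP => u v; rewrite !mxE; case: ifP => _; rewrite ?rmorphN rmorph1.
Qed.

Lemma oracle_signK K M (x : 'I_K) :
  oracle_sign R M x *m oracle_sign R M x = 1%:M.
Proof.
rewrite /oracle_sign mulmx_diag -diag_const_mx; congr diag_mx.
by apply/matrixP => u v; rewrite !mxE; case: ifP => _; rewrite ?mulrNN mulr1.
Qed.

(** Each summand is twice the projector onto item [x], and these projectors resolve the identity. *)
Lemma sum_oracle_defect K M :
  \sum_(x < K) (1%:M - oracle_sign R M x) = (2%R)%:C *: 1%:M.
Proof.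
apply/matrixP => u v; rewrite summxE [RHS]mxE.
under eq_bigr => x _ do rewrite !mxE -mulrnBl.
rewrite sumrMnl mxE mulrnAr mulr1; congr (_ *+ _).
have hK : (u %/ M < K)%N.
  by rewrite ltn_divLR ?ltn_ord//; case: M u v => // u; rewrite muln0 in u *; case: u.
rewrite (bigD1 (Ordinal hK))//= eqxx big1 ?addr0; last first.
  by move=> y; rewrite -val_eqE /= eq_sym => /negbTE ->; rewrite subrr.
by rewrite opprK [RHS]rmorph_nat mulr2n.
Qed.

Lemma block_psd_conj n d (X : 'I_n -> 'I_n -> 'M[C]_d) (A : 'I_n -> 'M[C]_d) :
  block_psd X -> block_psd (fun a b => adjmx (A a) *m X a b *m A b).
Proof.
move=> hX w; have := hX (fun a => A a *m w a); congr (0 <= _).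
by apply: eq_bigr => a _; apply: eq_bigr => b _; rewrite adjmxM !mulmxA.
Qed.

(** One call adds at most 2 to the root of the summed gap: the squared displacements
    [|(U_x - 1) psi_0|^2 = 2 D x] sum to 4, because [psi_0] does not depend on [x]. *)
Lemma shadowed_step K M j (sigma : 'I_K -> 'M[C]_(K * M))
    (T T' : 'M[C]_(K * M) -> 'M[C]_(K * M)) :
  shadowed j sigma -> cptp T -> cptp T' ->
  shadowed j.+1 (fun x => T' (@oracle R K M x (T (sigma x)))).
Proof.
move=> [rho [X [tr1 hX hgap]]] [_ [cpT trT]] [_ [cpT' trT']].
pose U (x : 'I_K) (a : 'I_2) := if a == 0 then 1%:M else oracle_sign R M x.
have adU x a : adjmx (U x a) = U x a.
  rewrite /U; case: ifP => _; last exact: adjmx_oracle_sign.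
  by rewrite /adjmx map_mx1 trmx1.
pose Y x a b := T' (U x a *m T (X x a b) *m U x b).
exists (T' (T rho)), Y; split.
- by rewrite trT' trT.
- move=> x; have [pX X0 X1 trs] := hX x; split.
  + apply: cpT'; have := block_psd_conj (U x) (cpT _ _ pX).
    by under [X in block_psd X]eq_fun => a do under eq_fun => b do rewrite adU.
  + by rewrite /Y X0 /U eqxx mul1mx mulmx1.
  + by rewrite /Y X1 /U.
  + by rewrite trT' /oracle mxtrace_mulC mulmxA oracle_signK mul1mx trT.
have rtrT' A : rtr (T' A) = rtr A by rewrite /rtr trT'.
have rtrT A : rtr (T A) = rtr A by rewrite /rtr trT.
have -> : 2 * j.+1%:R = 2 * j%:R + 2 :> R by rewrite -[j.+1]addn1 natrD mulrDr mulr1.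
apply: minkowski_param => // t t0.
pose D x := rtr rho - rtr (oracle_sign R M x *m T rho).
have sumD : \sum_x D x = 2.
  have Dx x : D x = rtr ((1%:M - oracle_sign R M x) *m T rho).
    by rewrite mulmxBl mul1mx rtrD rtrN rtrT.
  under eq_bigr => x _ do rewrite Dx.
  rewrite -rtr_sum -mulmx_suml sum_oracle_defect -scalemxAl mul1mx rtrZ rtrT.
  by rewrite rtr_density ?mulr1.
apply: (@le_trans _ _ ((1 + t) * (\sum_x gap (X x)) +
                       2 * (1 + t^-1) * \sum_x D x)).
  rewrite 2!mulr_sumr -big_split /=; apply: ler_sum => x _.
  have [pX X0 _ _] := hX x.
  have := gap_oracle (cpT _ _ pX) (adjmx_oracle_sign M x) (oracle_signK M x) t0.
  by rewrite /gap !rtrT X0 /Y !rtrT' /U /= !mul1mx !mulmx1 !rtrT X0.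
rewrite sumD (_ : 2 * _ * 2 = (1 + t^-1) * 2 ^+ 2); last by ring.
by rewrite lerD2r ler_wpM2l// addr_ge0// ltW.
Qed.

(** * Depolarizing noise as a mixture of restarts *)

Lemma linear_comb (V W : lmodType C) (f : V -> W) : linear f ->
  forall a b u v, f (a *: u + b *: v) = a *: f u + b *: f v.
Proof.
move=> hf a b u v; rewrite hf; congr (_ + _).
have f0 : f 0 = 0 by have := hf (-1) 0 0; rewrite scaler0 addr0 scaleN1r addNr.
by have := hf b v 0; rewrite addr0 f0 addr0.
Qed.

(* Mean of (2J+1)^2, where J is the number of calls since the noise last fired,
   when j calls have been made since then and k noisy steps remain. *)
Definition noisy_bound (p : R) (j k : nat) : R :=
  1 + 8 * (\sum_(i < k) i.+1%:R * (1 - p) ^+ i) +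
  (1 - p) ^+ k * (4 * (j + k)%:R * (j + k).+1%:R - 4 * k%:R * k.+1%:R).

(** Conditioning on the next step: if the noise fires, that step's own call sets the count to 1;
    otherwise the count becomes [j.+1]. The closed form comes from [(2J+1)^2 = 1 + 4J(J+1)] by Abel
    summation. *)
Lemma noisy_boundS p j k :
  noisy_bound p j k.+1 = p * noisy_bound p 1 k + (1 - p) * noisy_bound p j.+1 k.
Proof.
rewrite /noisy_bound big_ord_recr /= exprS; set S := \sum_(i < k) _.
set q := (1 - p) ^+ k; rewrite !addnS !addSn !add0n -!natr1 natrD.
by ring.
Qed.

Lemma density_mixed d : (0 < d)%N -> density ((d%:R^-1 : C) *: (1%:M : 'M[C]_d)).
Proof.
move=> d0; split; last by rewrite mxtraceZ mxtrace1 mulVf// pnatr_eq0 -lt0n.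
move=> v; rewrite -scalemxAr -scalemxAl mulmx1 mxE mulr_ge0 ?invr_ge0//.
rewrite mxE; apply: sumr_ge0 => i _; rewrite !mxE mulrC; exact: mulcJ_ge0.
Qed.

Definition noisy_step (p : R) K M (rd : round R K M) (x : 'I_K)
    (rho : 'M[C]_(K * M)) (i : nat) : 'M[C]_(K * M) :=
  chT' rd i (oracle x (chT rd i (depol p rho))).

Lemma oracle_comb K M (x : 'I_K) a b (u v : 'M[C]_(K * M)) :
  oracle x (a *: u + b *: v) = a *: oracle x u + b *: oracle x v.
Proof. by rewrite /oracle mulmxDr mulmxDl -!scalemxAr -!scalemxAl. Qed.

Lemma depol_comb p d a b (u v : 'M[C]_d) :
  depol p (a *: u + b *: v) = a *: depol p u + b *: depol p v.
Proof.
rewrite /depol mxtraceD !mxtraceZ mulrDr scalerDl !scalerDr !scalerA addrACA.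
by rewrite (mulrCA _ a) (mulrCA _ b) (mulrC _ a) (mulrC _ b).
Qed.

Definition valid_steps K M (rd : round R K M) (s : seq nat) :=
  forall i, i \in s -> cptp (chT rd i) /\ cptp (chT' rd i).

Lemma foldl_noisy_comb p K M (rd : round R K M) x s a b (u v : 'M[C]_(K * M)) :
  valid_steps rd s ->
  foldl (noisy_step p rd x) (a *: u + b *: v) s =
  a *: foldl (noisy_step p rd x) u s + b *: foldl (noisy_step p rd x) v s.
Proof.
elim: s u v => //= i s IH u v hs.
have [[linT _] [linT' _]] := hs i (mem_head _ _).
have -> : noisy_step p rd x (a *: u + b *: v) i =
    a *: noisy_step p rd x u i + b *: noisy_step p rd x v i.
  by rewrite /noisy_step depol_comb (linear_comb linT) oracle_comb (linear_comb linT').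
by apply: IH => k ks; apply: hs; rewrite inE ks orbT.
Qed.

Lemma rtr_mul_comb d (a b : R) (E A B : 'M[C]_d) :
  rtr (E *m (a%:C *: A + b%:C *: B)) = a * rtr (E *m A) + b * rtr (E *m B).
Proof. by rewrite mulmxDr rtrD -2!scalemxAr 2!rtrZ. Qed.

Lemma sumr_comb (I : finType) (F G H : I -> R) (a b : R) :
  (forall x, F x = a * G x + b * H x) ->
  \sum_x F x = a * \sum_x G x + b * \sum_x H x.
Proof. by move=> h; rewrite !mulr_sumr -big_split; exact: eq_bigr. Qed.

(** Induction on the remaining steps for all [j] and [sigma] at once, since the two branches of a
    noisy step continue from different shadowed families. *)
Lemma noisy_success p K M (rd : round R K M) s j (sigma : 'I_K -> 'M[C]_(K * M)) :
  0 < p < 1 -> (0 < K * M)%N -> povm (meas rd) -> valid_steps rd s ->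
  shadowed j sigma ->
  \sum_x rtr (meas rd x *m foldl (noisy_step p rd x) (sigma x) s)
  <= noisy_bound p j (size s).
Proof.
move=> /andP[p0 p1] d0 hE; elim: s j sigma => [|i s IH] j sigma hs hsig.
  apply: le_trans (shadowed_success hsig hE) _; rewrite /noisy_bound /= big_ord0 expr0.
  by rewrite addn0 -[j.+1]addn1 natrD le_eqVlt; apply/orP; left; apply/eqP; ring.
have [hT hT'] := hs i (mem_head _ _).
have hs' : valid_steps rd s by move=> k ks; apply: hs; rewrite inE ks orbT.
pose mixed : 'M[C]_(K * M) := ((K * M)%:R^-1 : C) *: 1%:M.
pose clean (rho : 'M[C]_(K * M)) x := chT' rd i (@oracle R K M x (chT rd i rho)).
(* The unit trace recorded in [shadowed] makes [depol] a convex combination of [mixed] and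
   [sigma x]. *)
have stepE x : noisy_step p rd x (sigma x) i =
    p%:C *: clean mixed x + (1 - p)%:C *: clean (sigma x) x.
  have [rho [X [_ /(_ x)[_ _ _ trs] _]]] := hsig.
  rewrite /noisy_step /depol trs mulr1 -scalerA.
  by rewrite (linear_comb hT.1) oracle_comb (linear_comb hT'.1).
pose F tau x := rtr (meas rd x *m foldl (noisy_step p rd x) (tau x) s).
have comb x : rtr (meas rd x *m foldl (noisy_step p rd x) (sigma x) (i :: s)) =
    p * F (clean mixed) x + (1 - p) * F (fun x => clean (sigma x) x) x.
  rewrite -[foldl _ _ _]/(foldl _ (noisy_step p rd x (sigma x) i) s) stepE.
  by rewrite foldl_noisy_comb// rtr_mul_comb.
rewrite (sumr_comb comb) noisy_boundS; apply: lerD.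
  rewrite ler_wpM2l ?(ltW p0)//; apply: (IH 1%N (clean mixed)) => //.
  exact: (shadowed_step (shadowed_const _ (density_mixed d0)) hT hT').
rewrite ler_wpM2l ?subr_ge0 ?(ltW p1)//.
apply: (IH j.+1 (fun x => clean (sigma x) x)) => //.
exact: shadowed_step.
Qed.

(** * Geometric sums and the success probability of one round *)

(** Powers of [1 - p] decrease, so the term is at most the sum of [(1 - p) ^+ l] over [l <= i]; [h]
    is this bound times [p]. *)
Lemma geometric_term_le (p : R) (i : nat) : 0 < p < 1 ->
  i.+1%:R * (1 - p) ^+ i <= p^-1.
Proof.
move=> /andP[p0 p1]; have q0 : 0 <= 1 - p by rewrite subr_ge0 ltW.
suff h : i.+1%:R * p * (1 - p) ^+ i <= 1 - (1 - p) ^+ i.+1.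
  rewrite -(ler_pM2r p0) mulVf ?gt_eqF// mulrAC; apply: le_trans h _.
  by rewrite gerBl exprn_ge0.
elim: i => [|i IH]; first by rewrite mul1r expr0 expr1; lra.
have := exprn_ge0 i.+1 q0; have := exprn_ile1 i.+1 q0.
rewrite gerBl (ltW p0) => /(_ isT).
move: IH; rewrite (exprS _ i) (exprS _ i.+1) (exprS _ i) -[i.+2]addn1 natrD.
set q := (1 - p) ^+ i; set m := i.+1%:R => IH h1 h0.
have := ler_wpM2l q0 IH; nra.
Qed.

Lemma geometric_sum_le (p : R) (k : nat) : 0 < p < 1 ->
  \sum_(i < k) i.+1%:R * (1 - p) ^+ i <= (p ^+ 2)^-1.
Proof.
move=> /andP[p0 p1]; have q0 : 0 <= 1 - p by rewrite subr_ge0 ltW.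
have e : p ^+ 2 * (\sum_(i < k) i.+1%:R * (1 - p) ^+ i) =
    1 - (1 - p) ^+ k * (1 + k%:R * p).
  elim: k => [|k IH]; first by rewrite big_ord0 expr0; ring.
  by rewrite big_ord_recr /= mulrDr IH (exprS _ k) -[k.+1]addn1 natrD; ring.
rewrite -(ler_pM2l (exprn_gt0 2 p0)) e divff ?expf_neq0 ?gt_eqF//.
by rewrite gerBl mulr_ge0 ?exprn_ge0// addr_ge0// mulr_ge0// ltW.
Qed.

(** Each of the [k] terms costs at most [8 / p]; the leading 1 is charged to the verification query
    counted in [k.+1]. *)
Lemma noisy_bound_le_linear (p : R) (k : nat) : 0 < p < 1 ->
  noisy_bound p 0 k <= 8 / p * k.+1%:R.
Proof.
move=> hp; have /andP[p0 p1] := hp.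
rewrite /noisy_bound add0n subrr mulr0 addr0 -[k.+1]addn1 natrD mulrDr mulr1 addrC.
apply: lerD; last by rewrite ler_pdivlMr//; lra.
rewrite -mulrA ler_wpM2l// mulr_natr -[X in _ *+ X](card_ord k) -sumr_const.
by apply: ler_sum => i _; exact: geometric_term_le.
Qed.

Lemma noisy_bound_le_const (p : R) (k : nat) : 0 < p < 1 ->
  noisy_bound p 0 k <= 1 + 8 / p ^+ 2.
Proof.
move=> hp; rewrite /noisy_bound add0n subrr mulr0 addr0 lerD2l ler_wpM2l//.
exact: geometric_sum_le.
Qed.

Lemma round_success_le p K M (rd : round R K M) :
  0 < p < 1 -> (0 < K)%N -> round_valid rd ->
  round_success p rd <= noisy_bound p 0 (nq rd) / K%:R.
Proof.
move=> hp K0 [hinit [hch hmeas]].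
(* In dimension zero the trace of [init rd] would be an empty sum instead of 1. *)
have d0 : (0 < K * M)%N.
  rewrite lt0n; apply/eqP => KM0; have [_] := hinit.
  rewrite /mxtrace big1 => [/esym/eqP|i]; first by rewrite oner_eq0.
  by have := ltn_ord i; rewrite {2}KM0.
rewrite mulrC /round_success ler_wpM2l ?invr_ge0//.
have hs : valid_steps rd (iota 0 (nq rd)).
  by move=> i; rewrite mem_iota => /andP[_ ?]; exact: hch.
have := noisy_success hp d0 hmeas hs (shadowed_const K hinit).
by rewrite size_iota.
Qed.

End Rounds.

(** * From success bounds per round to a bound on the total number of queries *)

Section Tradeoff.
Set Implicit Arguments. Unset Strict Implicit. Unset Printing Implicit Defensive.
Variable R : realType.

(** Taking inverses, [1 / (1 - s) = 1 + s / (1 - s) <= expR (s / (1 - s))], and the exponent is at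
    most [y / (1 - eta)]. *)
Lemma expRN_le_onem (s y eta : R) : s <= y -> 0 <= y -> s <= eta -> eta < 1 ->
  expR (- (y / (1 - eta))) <= 1 - s.
Proof.
move=> sy y0 seta eta1; have e0 : 0 < 1 - eta by rewrite subr_gt0.
have s0 : 0 < 1 - s by rewrite subr_gt0 (le_lt_trans seta).
rewrite expRN -[leRHS]invrK lef_pV2 ?posrE ?expR_gt0 ?invr_gt0//.
have -> : (1 - s)^-1 = 1 + s / (1 - s) by field; rewrite gt_eqF.
apply: le_trans (expR_ge1Dx _) _; rewrite ler_expR.
have [s_le0|s_gt0] := leP s 0.
  apply: (@le_trans _ _ 0); last by rewrite divr_ge0// ltW.
  by rewrite pmulr_lle0// invr_gt0.
apply: ler_pM => //; first exact: ltW.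
  by rewrite invr_ge0 ltW.
by rewrite lef_pV2 ?posrE// lerD2l lerN2.
Qed.

(** Each failure factor is bounded below by an exponential; the exponents add up to a multiple of
    [Q], and taking logarithms gives the claim. *)
Lemma queries_tradeoff (c B eps eta : R) (n r : nat) (s : 'I_r.+1 -> R)
    (k : 'I_r.+1 -> nat) (Q := (\sum_g (k g).+1)%N) :
  0 <= c -> 0 <= B -> 0 < eps -> (Q < n)%N ->
  (forall g, s g <= c * (k g).+1%:R / (n - g)%:R) ->
  (forall g, s g <= B / (n - g)%:R) ->
  B / (n - Q)%:R <= eta -> eta < 1 ->
  \prod_g (1 - s g) <= eps ->
  (1 - eta) * ln (1 / eps) * (n - Q)%:R <= c * Q%:R.
Proof.
move=> c0 B0 eps0 Qn hs1 hs2 hB eta1 hprod.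
have e0 : 0 < 1 - eta by rewrite subr_gt0.
have nQ : 0 < (n - Q)%:R :> R by rewrite ltr0n subn_gt0.
(* Every round makes at least one query, so [g <= r < Q] and [n - Q] is below every denominator
   [n - g]. *)
have rQ : (r < Q)%N.
  apply: (@leq_trans (\sum_(g < r.+1) 1)%N); first by rewrite sum1_card card_ord.
  exact: leq_sum.
have ninv (g : 'I_r.+1) : (n - g)%:R^-1 <= (n - Q)%:R^-1 :> R.
  have gQ : (n - Q <= n - g)%N by rewrite leq_sub2l// ltnW// (leq_trans (ltn_ord g)).
  by rewrite lef_pV2 ?posrE// ?ler_nat// (lt_le_trans nQ)// ler_nat.
pose y g := c * (k g).+1%:R / (n - Q)%:R.
have hy g : expR (- (y g / (1 - eta))) <= 1 - s g.
  apply: expRN_le_onem => //.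
  - by apply: le_trans (hs1 g) _; rewrite ler_wpM2l// mulr_ge0.
  - by rewrite !mulr_ge0// invr_ge0 ltW.
  - apply: le_trans (hs2 g) (le_trans _ hB); exact: ler_wpM2l.
have hexp : expR (- (c * Q%:R / ((n - Q)%:R * (1 - eta)))) <= eps.
  apply: le_trans hprod; rewrite /Q natr_sum mulr_sumr mulr_suml -sumrN expR_sum.
  apply: ler_prod => g _; rewrite expR_ge0 /=; apply: le_trans (hy g).
  by rewrite /y invfM mulrA.
have : ln (1 / eps) <= c * Q%:R / ((n - Q)%:R * (1 - eta)).
  by rewrite div1r lnV ?posrE// lerNl -ler_expR lnK ?posrE.
rewrite ler_pdivlMr ?mulr_gt0//; apply: le_trans.
by rewrite le_eqVlt; apply/orP; left; apply/eqP; ring.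
Qed.
End Tradeoff.

(** * Choice of the constants and the final estimate *)

Theorem theorem5 (R : realType) (p eps : R) :
  0 < p < 1 -> 0 < eps < 1 ->
  exists Cs : nat -> R,
    Cs @ \oo --> (1 : R^o) /\
    forall (N : nat) (A : excl_alg R N),
      alg_valid A -> alg_failure p A <= eps ->
      N%:R / (1 + 8 * Cs N / (p * ln (1 / eps))) <= (alg_queries A)%:R.
Proof.
move=> hp /andP[e0 e1]; have /andP[p0 p1] := hp.
set L := ln (1 / eps).
have L0 : 0 < L by rewrite ln_gt0// div1r invf_gt1.
pose c := 8 / p; have c0 : 0 < c by rewrite divr_gt0.
pose B := 1 + 8 / p ^+ 2.
have B0 : 0 < B by rewrite addr_gt0// divr_gt0// exprn_gt0.
(* If the bound fails with constant 1, then [Q < N * L / (L + c)], so [N - Q] exceeds [delta * N].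
   With [A0] as below, [B / (N - Q)] is then at most [A0 / (2 * N)]. *)
pose delta := c / (L + c).
have d0 : 0 < delta by rewrite divr_gt0// addr_gt0.
pose A0 := 2 * B / delta; have A00 : 0 < A0 by rewrite divr_gt0// mulr_gt0.
(* The factor 2 pays for [harmonic N = 1 / (N + 1) >= 1 / (2 N)]. *)
pose D := 2 * (A0 + L / c * A0 ^+ 2).
have D0 : 0 <= D.
  by rewrite mulr_ge0// addr_ge0 ?(ltW A00)// mulr_ge0 ?exprn_ge0 ?(ltW A00)// divr_ge0 ?ltW.
(* For N <= A0 the term of D in A0^2 makes the claimed bound at most 1; for
   N > A0 either q is large or all success probabilities are at most
   eta = A0 / (2N) < 1/2, and 1 / (1 - eta) <= 1 + A0 / N. *)
exists (fun n => 1 + D * harmonic n); split.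
  rewrite -[X in _ --> X]addr0 -[X in _ --> _ + X](mulr0 D).
  apply: cvgD; first exact: cvg_cst.
  by apply: cvgMr; exact: cvg_harmonic.
move=> N A [rN vA] failA.
have N0 : 0 < N%:R :> R by rewrite ltr0n; case: N A rN {vA failA}.
set C := 1 + D * harmonic N; set Q := alg_queries A.
have C1 : 1 <= C by rewrite lerDl mulr_ge0// invr_ge0.
have N1 : 1 <= N%:R :> R by rewrite ler1n -(ltr0n R).
have X0 : 0 <= A0 + L / c * A0 ^+ 2 by move: D0; rewrite /D pmulr_rge0.
have Dharm : (A0 + L / c * A0 ^+ 2) / N%:R <= C - 1.
  rewrite /C addrAC subrr add0r /harmonic /D (mulrC 2) -(mulrA _ 2) ler_wpM2l//.
  rewrite ler_pdivlMr ?ltr0n// -[N.+1]addn1 natrD mulrDr mulVf ?gt_eqF// mulr1.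
  by rewrite -lerBrDl (_ : 2 - 1 = 1) ?invf_le1//; ring.
have -> : 8 * C / (p * L) = c * C / L by rewrite /c; field; rewrite !gt_eqF.
have C0 : 0 < C by rewrite (lt_le_trans _ C1).
have [cge Lge Cge] : [/\ 0 <= c, 0 <= L & 0 <= C] by rewrite !ltW.
rewrite ler_pdivrMr; last by rewrite addr_gt0// divr_gt0// mulr_gt0.
(* When the bound already holds with constant 1, it holds with [C >= 1]. *)
have [hN|hN] := leP N%:R (Q%:R * (1 + c / L)).
  apply: le_trans hN _; rewrite ler_wpM2l// lerD2l -(mulrA c) (mulrC C) mulrA.
  by rewrite ler_peMr// divr_ge0// ltW.
have [hA|hA] := leP N%:R A0.
  have Q1 : 1 <= Q%:R :> R.
    by rewrite ler1n /Q /alg_queries big_ord_recl addSn.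
  apply: (@le_trans _ _ (1 + c * C / L)); last first.
    by rewrite ler_peMl// addr_ge0// divr_ge0// mulr_ge0.
  suff h : L / c * N%:R <= C.
    apply: (@le_trans _ _ (c * C / L)); last by rewrite lerDr.
    move: h; rewrite ler_pdivlMr// -(ler_pM2l c0); apply: le_trans.
    by rewrite le_eqVlt; apply/orP; left; apply/eqP; field; rewrite gt_eqF.
  apply: (@le_trans _ _ (C - 1)); last by rewrite gerBl.
  apply: le_trans Dharm; rewrite ler_pdivlMr//.
  apply: (@le_trans _ _ (L / c * A0 ^+ 2)); last by rewrite lerDr ltW.
  rewrite -(mulrA (L / c)) -expr2 ler_wpM2l//; first by rewrite divr_ge0.
  by rewrite ler_pXn2r// nnegrE ltW.
have QN : (Q < N)%N.
  rewrite -(ltr_nat R); apply: le_lt_trans hN; rewrite ler_peMr// lerDl.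
  by rewrite divr_ge0// ltW.
have NQ : (N - Q)%:R = N%:R - Q%:R :> R by rewrite natrB// ltnW.
have hdelta : delta * N%:R <= (N - Q)%:R.
  have LC0 : 0 < L + c by rewrite addr_gt0.
  rewrite NQ /delta mulrAC ler_pdivrMr//.
  have : Q%:R * (1 + c / L) * L = Q%:R * (L + c) by field; rewrite gt_eqF.
  by move: hN; rewrite -(ltr_pM2r L0) => /[swap] ->; nra.
pose eta := A0 / (2 * N%:R).
have eta_le : eta < 2^-1 by rewrite /eta ltr_pdivrMr ?mulr_gt0// mulKf.
have := @queries_tradeoff R c B eps eta N (nrounds A)
  (fun g => round_success p (@rounds R N A g)) (fun g => nq (@rounds R N A g))
  (ltW c0) (ltW B0) e0 QN.
have rs g : round_success p (@rounds R N A g) <=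
    noisy_bound p 0 (nq (@rounds R N A g)) / (N - g)%:R.
  by apply: round_success_le => //; rewrite subn_gt0 (leq_trans (ltn_ord g)).
move=> /(_ _ _ _ _ failA) H.
have {H} : (1 - eta) * L * (N - Q)%:R <= c * Q%:R.
  apply: H.
  - by move=> g; apply: le_trans (rs g) _; rewrite ler_wpM2r// noisy_bound_le_linear.
  - by move=> g; apply: le_trans (rs g) _; rewrite ler_wpM2r// noisy_bound_le_const.
  - have -> : eta = B / (delta * N%:R) by rewrite /eta /A0; field; rewrite !gt_eqF.
    have dN : 0 < delta * N%:R by exact: mulr_gt0.
    by rewrite ler_wpM2l ?(ltW B0)// lef_pV2// posrE// ltr0n subn_gt0.
  - by rewrite (lt_trans eta_le)// invf_lt1// ltr1n.
(* [(1 + 2 * eta) * (1 - eta) = 1 + eta * (1 - 2 * eta)], which is at least 1 as [eta < 1/2]. *)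
have hC : 1 <= C * (1 - eta).
  have : 1 + 2 * eta <= C.
    rewrite -lerBrDl; apply: le_trans Dharm.
    have -> : 2 * eta = A0 / N%:R by rewrite /eta; field; rewrite gt_eqF.
    by rewrite ler_wpM2r// lerDl mulr_ge0 ?exprn_ge0 ?(ltW A00)// divr_ge0 ?ltW.
  have eta0 : 0 < eta by rewrite divr_gt0// mulr_gt0.
  by move: eta_le; nra.
rewrite -(ler_pM2l C0) => h.
have {}h : L * (N - Q)%:R <= C * (c * Q%:R).
  by apply: le_trans h; rewrite -(mulrA (1 - eta)) (mulrA C) ler_peMl// mulr_ge0.
have -> : Q%:R * (1 + c * C / L) = Q%:R + C * (c * Q%:R) / L.
  by field; rewrite gt_eqF.
by rewrite -lerBlDl ler_pdivlMr// -NQ mulrC.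
Qed.
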